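(* Let $M$ be an atom-free MVS and let $\{X_i : i=1,2,\dots,n\}$ be a finite collection of $M$-metrizable spaces. Then the product space $X=X_1\times\dots\times X_n$ (with the product topology) is $M$-metrizable.
   Context: A metric value set (MVS) is a set $M$ with at least two elements and a binary operation $+$ such that: (M1) $+$ is associative; (M2) $+$ has a (two-sided) neutral element $e$, and we write $M^{*}=M\setminus\{e\}$; (M3) if $m_1+m_2=e$ then $m_1=m_2=e$; (M4) for all $m_1,m_2\in M^{*}$ there are $m_3\in M^{*}$ and $m_4,m_5\in M$ with $m_1=m_3+m_4$ and $m_2=m_3+m_5$. For $m_1,m_2\in M$ write $m_1\unlhd m_2$ if $m_1+m_3=m_2$ for some $m_3\in M$, and $m_1\lhd m_2$ if $m_1+m_3=m_2$ for some $m_3\in M^{*}$ (so $m\lhd m$ is possible). $M$ is atom-free if $+$ is commutative and for every $m\in M^{*}$ there is $n\in M^{*}$ with $n\lhd m$. A quasimetric function is a map $f\colon X\times X\to M$ with $f(x,x)=e$ for all $x\in X$ and $f(x,z)\unlhd f(x,y)+f(y,z)$ for all $x,y,z\in X$ (no symmetry is required). It induces the topology $\mathcal{T}_f$ on $X$ in which, for every $x\in X$, the balls $B_f(x,m)=\{y\in X: f(x,y)\lhd m\}$, $m\in M^{*}$, form an open neighbourhood base at $x$. A topological space $(X,\mathcal{T})$ is $M$-metrizable if $\mathcal{T}=\mathcal{T}_f$ for some quasimetric function $f\colon X\times X\to M$. *)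

(* Defs.v *)
From mathcomp Require Import all_boot all_classical all_analysis.

Set Implicit Arguments.
Unset Strict Implicit.
Unset Printing Implicit Defensive.

Local Open Scope classical_set_scope.

Declare Scope mvs_scope.
Delimit Scope mvs_scope with mvs.

(* Metric value sets. [+] is not assumed commutative, hence no [nmodType]. *)
Record mvs := Mvs {
  mvs_sort :> Type;
  mvs_add : mvs_sort -> mvs_sort -> mvs_sort;
  mvs_e : mvs_sort;
  mvs_two_elements : exists m1 m2 : mvs_sort, m1 <> m2;
  mvs_addA : associative mvs_add;
  mvs_add_el : left_id mvs_e mvs_add;
  mvs_add_er : right_id mvs_e mvs_add;
  mvs_add_eq_e : forall m1 m2 : mvs_sort,
    mvs_add m1 m2 = mvs_e -> m1 = mvs_e /\ m2 = mvs_e;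
  mvs_common_part : forall m1 m2 : mvs_sort, m1 <> mvs_e -> m2 <> mvs_e ->
    exists m3 m4 m5 : mvs_sort,
      [/\ m3 <> mvs_e, m1 = mvs_add m3 m4 & m2 = mvs_add m3 m5]
}.

Bind Scope mvs_scope with mvs_sort.
Arguments mvs_add {m} _ _.
Arguments mvs_e {m}.
Notation "x + y" := (mvs_add x y) : mvs_scope.
Local Notation e := (@mvs_e _) (only parsing).

Local Open Scope mvs_scope.

Definition mvs_le (M : mvs) (m1 m2 : M) := exists m3 : M, m1 + m3 = m2.

(* Not the strict part of [mvs_le]: [mvs_lt m m] may hold. *)
Definition mvs_lt (M : mvs) (m1 m2 : M) := exists2 m3 : M, m3 <> e & m1 + m3 = m2.

Definition atom_free (M : mvs) :=
  commutative (@mvs_add M) /\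
  forall m : M, m <> e -> exists2 n : M, n <> e & mvs_lt n m.

Definition quasimetric (M : mvs) (X : Type) (f : X -> X -> M) :=
  (forall x, f x x = e) /\ (forall x y z, mvs_le (f x z) (f x y + f y z)).

Definition qball (M : mvs) (X : Type) (f : X -> X -> M) (x : X) (m : M) : set X :=
  [set y | mvs_lt (f x y) m].

(* The topology of [X] is the one induced by [f]: at each point the balls of
   nontrivial radius form an open neighbourhood base. This determines the
   topology, see [induces_topologyP]. *)
Definition induces_topology (M : mvs) (X : topologicalType) (f : X -> X -> M) :=
  forall x : X,
    (forall m : M, m <> e -> open_nbhs x (qball f x m)) /\
    (forall U : set X, nbhs x U -> exists2 m : M, m <> e & qball f x m `<=` U).

Definition metrizable (M : mvs) (X : topologicalType) :=
  exists2 f : X -> X -> M, quasimetric f & induces_topology f.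

Lemma induces_topologyP (M : mvs) (X : topologicalType) (f : X -> X -> M) :
  quasimetric f ->
  induces_topology f <->
  forall U : set X, open U <->
    forall x, U x -> exists2 m : M, m <> e & qball f x m `<=` U.
Proof.
move=> [f0 ft]; split=> [fT U|fT x].
  split=> [oU x Ux|bU].
    by apply: (fT x).2; exact: open_nbhs_nbhs.
  rewrite openE => x /bU[m m0 mU].
  by apply: filterS mU _; apply: open_nbhs_nbhs; exact: (fT x).1.
split=> [m m0|U].
  split; last by exists m; rewrite // f0 mvs_add_el.
  apply/fT => y [k k0 yk]; exists k => // z [j j0 zj].
  have [i xz] := ft x y z; exists (i + j).
    by move=> /mvs_add_eq_e[_ /j0].
  by rewrite mvs_addA xz -mvs_addA zj.
rewrite nbhsE => -[V [/fT oV Vx] VU].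
by have [m m0 mV] := oV _ Vx; exists m => // y /mV /VU.
Qed.

(* Main.v *)
Require Import Defs.
From mathcomp Require Import all_boot all_classical all_analysis.

(** The product is metrized by the sum of coordinate distances,
    [f x y = \sum_i f_i (x i) (y i)].

    Commutativity of [M] lets the coordinatewise triangle inequalities be added
    up, so [f] is a quasimetric.  Each summand lies below the sum
    ([term_le_bigsum]), so the [f]-ball of radius [m] lies in every
    coordinate cylinder over a ball of radius [m]; this makes the ball
    neighbourhoods of [f] at least as fine as the product topology
    ([prod_cvg]).  For the other comparison a nontrivial radius has to be shared
    among finitely many coordinates.  In an atom-free [M] every [m <> e] is a
    sum of two nontrivial elements, and their nontrivial common part [h] given
    by (M4) satisfies [h + h <= m] ([halving]).  Iterating this gives, for each
    number of terms, a nontrivial [k] such that the sum of that many elements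
    strictly below [k] is strictly below [m] ([bigsum_lt]); the box of balls of
    radius [k] then lies in the [f]-ball of radius [m]. *)

Set Implicit Arguments.
Unset Strict Implicit.
Unset Printing Implicit Defensive.

Local Open Scope classical_set_scope.
Local Open Scope mvs_scope.

Local Notation e := mvs_e.

Lemma mvs_nontrivial (M : mvs) : exists m : M, m <> e.
Proof.
have [a [b ab]] := mvs_two_elements M.
by have [ae|] := EM (a = e); [exists b => be; apply: ab; rewrite ae be|exists a].
Qed.

Lemma mvs_le_lt_trans (M : mvs) (a b m : M) :
  mvs_le a b -> mvs_lt b m -> mvs_lt a m.
Proof.
move=> [c <-] [d d0 <-]; exists (c + d); last by rewrite mvs_addA.
by move=> /mvs_add_eq_e[_ /d0].
Qed.

Lemma mvs_lt_le_trans (M : mvs) (a b m : M) :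
  mvs_lt a b -> mvs_le b m -> mvs_lt a m.
Proof.
move=> [c c0 <-] [d <-]; exists (c + d); last by rewrite mvs_addA.
by move=> /mvs_add_eq_e[/c0].
Qed.

(** (M4) says that two nontrivial radii have a nontrivial common lower bound,
    which is what makes balls a filter base. *)
Lemma mvs_common_lower_bound (M : mvs) (a b : M) : a <> e -> b <> e ->
  exists2 k : M, k <> e & mvs_le k a /\ mvs_le k b.
Proof.
move=> a0 b0; have [k [c [d [k0 -> ->]]]] := mvs_common_part a0 b0.
by exists k => //; split; [exists c|exists d].
Qed.

Section CommutativeSums.
Variable M : mvs.
Hypothesis addC : commutative (@mvs_add M).

Local Notation "\sum_ ( i <- r ) F" := (\big[@mvs_add M/e]_(i <- r) F).

Lemma mvs_addACA (a b c d : M) : (a + b) + (c + d) = (a + c) + (b + d).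
Proof. by rewrite !mvs_addA -(mvs_addA a) (addC b) !mvs_addA. Qed.

Lemma mvs_lt_add (a b c d : M) :
  mvs_lt a c -> mvs_lt b d -> mvs_lt (a + b) (c + d).
Proof.
move=> [a' a'0 <-] [b' b'0 <-]; exists (a' + b'); last exact: mvs_addACA.
by move=> /mvs_add_eq_e[/a'0].
Qed.

Lemma term_le_bigsum n (i : 'I_n) (F : 'I_n -> M) :
  mvs_le (F i) (\sum_(j <- index_enum 'I_n) F j).
Proof.
have : i \in index_enum 'I_n by rewrite mem_index_enum.
elim: (index_enum _) => // j r IH; rewrite inE big_cons => /predU1P[<-|/IH[c <-]].
  by eexists; reflexivity.
by exists (F j + c); rewrite !mvs_addA (addC (F i)).
Qed.

Lemma bigsum_triangle (I : Type) (r : seq I) (F G H : I -> M) :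
  (forall i, mvs_le (F i) (G i + H i)) ->
  mvs_le (\sum_(i <- r) F i) (\sum_(i <- r) G i + \sum_(i <- r) H i).
Proof.
move=> FGH; apply: (big_rec3 (fun a b c => mvs_le a (b + c))) => [|i a b c _ [d abc]].
  by exists e; rewrite !mvs_add_el.
by have [t Ft] := FGH i; exists (t + d); rewrite mvs_addACA Ft abc mvs_addACA.
Qed.

End CommutativeSums.

(** Atom-freeness writes [m] as a sum of two nontrivial elements; their common
    part occurs in both summands, and commutativity collects the two copies. *)
Lemma halving (M : mvs) (m : M) : atom_free M -> m <> e ->
  exists2 h : M, h <> e & mvs_le (h + h) m.
Proof.
move=> [addC split_m] /split_m[a a0 [b b0 <-]].
have [h h0 [[c <-] [d <-]]] := mvs_common_lower_bound a0 b0.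
by exists h => //; exists (c + d); rewrite mvs_addACA.
Qed.

(** One half of [m] bounds the first term, and the other half is shared
    inductively among the remaining ones. *)
Lemma bigsum_lt (M : mvs) (I : Type) (r : seq I) (m : M) : atom_free M ->
  m <> e -> exists2 k : M, k <> e & forall F : I -> M,
    (forall i, mvs_lt (F i) k) -> mvs_lt (\big[mvs_add/e]_(i <- r) F i) m.
Proof.
move=> hM; elim: r m => [|i r IH] m m0.
  by exists m => // F _; rewrite big_nil; exists m; rewrite ?mvs_add_el.
have [h h0 hhm] := halving hM m0; have [k k0 Hk] := IH h h0.
have [l l0 [lh lk]] := mvs_common_lower_bound h0 k0; exists l => // F Fl.
rewrite big_cons; apply: mvs_lt_le_trans hhm; apply: (mvs_lt_add hM.1).
  exact: mvs_lt_le_trans (Fl i) lh.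
by apply: Hk => j; exact: mvs_lt_le_trans (Fl j) lk.
Qed.

Definition qball_nbhs (M : mvs) (X : Type) (f : X -> X -> M) (x : X) :
    set_system X :=
  filter_from [set m : M | m <> e] (qball f x).

Lemma qball_nbhs_filter (M : mvs) (X : Type) (f : X -> X -> M) (x : X) :
  Filter (qball_nbhs f x).
Proof.
apply: filter_from_filter; first exact: mvs_nontrivial.
move=> a b a0 b0; have [k k0 [ka kb]] := mvs_common_lower_bound a0 b0.
by exists k => // y yk; split; [exact: mvs_lt_le_trans ka|exact: mvs_lt_le_trans kb].
Qed.

(** Openness of balls is automatic for a quasimetric, so comparing
    neighbourhoods is enough. *)
Lemma induces_topology_nbhs (M : mvs) (X : topologicalType) (f : X -> X -> M) :
  quasimetric f -> (forall x U, nbhs x U <-> qball_nbhs f x U) ->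
  induces_topology f.
Proof.
move=> qf fT; apply/induces_topologyP => // U.
by rewrite openE; split=> UU x /UU /fT.
Qed.

(** The product topology is the supremum of the topologies pulled back along
    the coordinates, so convergence is tested one coordinate at a time. *)
Lemma prod_cvg (I : eqType) (X : I -> topologicalType)
    (F : set_system (prod_topology X)) (x : prod_topology X) : Filter F ->
  (forall i (V : set (X i)), nbhs (x i) V -> F (proj i @^-1` V)) -> F --> x.
Proof.
move=> FF Fx; apply/cvg_sup => i A [B [[W oW <-] /= Wx] WA].
by apply: filterS WA _; apply: Fx; exact: open_nbhs_nbhs.
Qed.

Theorem theorem1p12 (M : mvs) (hM : atom_free M) (n : nat)
    (X : 'I_n -> topologicalType) (hX : forall i : 'I_n, metrizable M (X i)) :
  metrizable M (prod_topology X).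
Proof.
pose f i := s2val (cid2 (hX i)).
have fP i : quasimetric (f i) /\ induces_topology (f i).
  by split; [exact: s2valP|exact: s2valP'].
pose g (x y : prod_topology X) : M := \big[mvs_add/e]_i f i (x i) (y i).
have qg : quasimetric g.
  split=> [x|x y z].
    by apply: (big_rec (fun a => a = e)) => // i a _ ->; rewrite (fP i).1.1 mvs_add_el.
  by apply: (bigsum_triangle hM.1) => i; exact: (fP i).1.2.
exists g => //; apply: induces_topology_nbhs => // x U; split=> [|[m m0 mU]].
  suff : qball_nbhs g x --> x by apply.
  apply: prod_cvg; first exact: qball_nbhs_filter.
  move=> i V xV; have [m m0 mV] := ((fP i).2 (x i)).2 V xV.
  exists m => // y xy; apply: mV; apply: mvs_le_lt_trans xy.
  exact: (term_le_bigsum hM.1 i (fun j => f j (x j) (y j))).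
have [k k0 km] := bigsum_lt (index_enum 'I_n) hM m0.
have box : \forall y \near x, forall i, qball (f i) (x i) k (y i).
  apply: (@filter_forall _ _ (fun i y => qball (f i) (x i) k (y i)) (nbhs x)) => i.
  have xk : nbhs (x i) (qball (f i) (x i) k).
    by apply: open_nbhs_nbhs; exact: ((fP i).2 (x i)).1.
  exact: (@proj_continuous _ X i x _ xk).
by apply: filterS box => y xy; apply: mU; exact: km.
Qed.
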